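(* Nontrivial integer solutions $(c,p,q)$ of the Diophantine system $$\begin{cases}c^2-(p^2+q^2)^2=\square,\\ c^2-(p^2-q^2)^2=\square\end{cases}$$ are given by the formulas $$c=k\cdot\sqrt{xz}\,(x+z)(xz+N^2),\qquad p^2=k\cdot xz(x+N)(z+N),\qquad q^2=k\cdot xz(x-N)(z-N),$$ where $k$ is an integer and $x$ and $z$ are nontrivial different rational solutions of an arbitrary congruent number equation $C_N$. (The integer $k$ and the solutions $x,z$ must be chosen so that $c$, $p$ and $q$ are integers.)
   Context: The symbol $\square$ denotes a perfect square (not necessarily the same one at each occurrence). For a squarefree positive integer $N$, the congruent number equation is $C_N:\ y^2=x^3-N^2x$. A rational solution $(x,y)$ of $C_N$ is nontrivial if $y\neq 0$; its first coordinate is also called a nontrivial rational solution of $C_N$. Thus $x$ and $z$ are the first coordinates of nontrivial rational solutions of the same equation $C_N$. A solution of the system corresponds to two Pythagorean triangles with common hypotenuse $c=c_1=c_2$, legs $a_1=p^2+q^2$, $a_2=p^2-q^2$ and other legs $b_1,b_2$. The solution is called nontrivial if both Pythagorean triangles exist and they are distinct: $a_1b_1c_1a_2b_2c_2\neq 0$; $cpq\neq 0$ and $p\neq q$.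
   Formalization: Completeness with integer k and nonnegative root fails, e.g. for (697,13,4), where k is a proper fraction; every nontrivial solution is shown to be given only after scaling (c,p,q) to (m²c, mp, mq), and with −c for c when c(p²−q²)<0. *)

(* Defs.v *)
From mathcomp Require Import all_boot all_order all_algebra.

Set Implicit Arguments.
Unset Strict Implicit.
Unset Printing Implicit Defensive.

Import Order.TTheory GRing.Theory Num.Theory.
Local Open Scope ring_scope.

Definition is_square (n : int) : Prop := exists b : int, n = b ^+ 2.

Definition is_solution (c p q : int) : Prop :=
  is_square (c ^+ 2 - (p ^+ 2 + q ^+ 2) ^+ 2) /\
  is_square (c ^+ 2 - (p ^+ 2 - q ^+ 2) ^+ 2).

(* The triangles are (a1, b1, c) and (a2, b2, c); the system fixes b1 and b2
   up to sign.  Signs of c, p, q are unrestricted.  The conditions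
   a1 b1 c1 a2 b2 c2 <> 0, c p q <> 0 and p <> q together are the definition of
   "both triangles exist and are distinct". *)
Definition nontrivial_solution (c p q : int) : Prop :=
  exists b1 b2 : int,
    let a1 := p ^+ 2 + q ^+ 2 in
    let a2 := p ^+ 2 - q ^+ 2 in
    [/\ c ^+ 2 - a1 ^+ 2 = b1 ^+ 2,
        c ^+ 2 - a2 ^+ 2 = b2 ^+ 2,
        a1 * b1 * c * (a2 * b2 * c) != 0,
        c * p * q != 0 &
        p != q].

Definition squarefree (N : nat) : Prop :=
  forall d : nat, (d ^ 2 %| N)%N -> d = 1%N.

(* x is the first coordinate of a nontrivial rational point of
   C_N : y^2 = x^3 - N^2 x. *)
Definition nontrivial_congruent (N : nat) (x : rat) : Prop :=
  exists y : rat, y != 0 /\ y ^+ 2 = x ^+ 3 - N%:R ^+ 2 * x.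

Definition admissible (N : nat) (x z : rat) : Prop :=
  [/\ (0 < N)%N, squarefree N,
      nontrivial_congruent N x, nontrivial_congruent N z & x != z].

(* The square root is the nonnegative one, taken in a real closed field R since
   x z is not assumed to be the square of a rational.  Num.sqrt is 0 on
   negative arguments, but for admissible x, z with x z < 0 and k <> 0 the last
   two equations would give p^2 and q^2 opposite signs.
   When k <> 0 the formulas force k > 0 and c to have the sign of p^2 - q^2, and
   the k attached to a given (c, p, q) is in general only rational: for
   (697, 13, 4) it is 1/237672798044746500.  Hence a solution is matched
   after c -> -c (the other square root) if needed and a scaling
   (c, p, q) -> (m^2 c, m p, m q). *)
Definition formulas (R : rcfType) (N : nat) (k : int) (x z : rat)
    (c p q : int) : Prop :=
  [/\ c%:~R = k%:~R * Num.sqrt (ratr (x * z))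
                * ratr ((x + z) * (x * z + N%:R ^+ 2)) :> R,
      (p%:~R) ^+ 2 = k%:~R * (x * z * (x + N%:R) * (z + N%:R)) :> rat &
      (q%:~R) ^+ 2 = k%:~R * (x * z * (x - N%:R) * (z - N%:R)) :> rat].

(* Main.v *)
Require Import Defs.
From mathcomp Require Import all_boot all_order all_algebra.
From mathcomp Require Import ring lra.

Set Implicit Arguments.
Unset Strict Implicit.
Unset Printing Implicit Defensive.

Import Order.TTheory GRing.Theory Num.Theory.
Local Open Scope ring_scope.

(** Put a1 = p^2 + q^2 and a2 = p^2 - q^2.  If (c, p, q) is given by the
    formulas with k <> 0, and xz = s^2 with s rational and positive, then
<<
      a1 = 2k s^2 (xz + N^2),      a2 = 2k s^2 N (x + z),
      c  = k s (x + z)(xz + N^2),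
>>
    so that a1 : c = 2s : (x + z) and a2 : c = 2sN : (xz + N^2).  These are the
    rational parametrizations of the two right triangles, whose other legs are
    therefore k s (xz + N^2)(x - z) and k s (x + z)(xz - N^2).  That xz is
    a rational square is where the curve is used: the product of the two curve
    equations is xz (x^2 - N^2)(z^2 - N^2) = (y y')^2, while the formulas give
    (pq)^2 = (k xz)^2 (x^2 - N^2)(z^2 - N^2).

    Conversely, inverting the parametrization gives
<<
      x = N (c + b1)(c + b2) / (a1 a2),   z = N (c - b1)(c + b2) / (a1 a2).
>>
    Modulo squares, x^3 - N^2 x equals N * 2c a1 a2 (b2 + b1)
    (lemma [triangle_x_curve]) and z^3 - N^2 z equals N * 2c a1 a2 (b2 - b1);
    the two agree because (b2 + b1)(b2 - b1) = a1^2 - a2^2 = (2pq)^2.  Hence N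
    has to be the squarefree part of n = 2c a1 a2 (b1 + b2), which is possible
    as soon as n > 0.  As |b1| < |b2|, this holds once c > 0 and b2 is given
    the sign of a2.  The remaining factor k is then a determined positive
    rational number, and scaling (p, q) by its denominator makes it an
    integer. *)

(** * Squares and squarefree parts *)

(** The integers are integrally closed: from n d^2 = a^2 with a / d reduced,
    d divides a. *)
Lemma is_square_of_rat (n : int) (r : rat) : n%:~R = r ^+ 2 -> is_square n.
Proof.
move=> nE.
have d0 : (denq r)%:~R != 0 :> rat by rewrite intr_eq0 denq_neq0.
have rE : r * (denq r)%:~R = (numq r)%:~R by rewrite numqE.
have ndE : n * denq r ^+ 2 = numq r ^+ 2.
  by apply: (@intr_inj rat); rewrite rmorphM /= !rmorphXn /= nE -rE exprMn.
have /dvdzP[e eE] : (denq r %| numq r)%Z.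
  by rewrite -(@dvdz_pexp2r _ _ 2) // -ndE dvdz_mull.
exists e; apply: (@intr_inj rat); rewrite nE rmorphXn /=; congr (_ ^+ 2).
by apply: (mulIf d0); rewrite rE eE rmorphM.
Qed.

Lemma squarefree_part (n : nat) : (0 < n)%N ->
  exists N r : nat, [/\ (0 < N)%N, squarefree N & n = (N * r ^ 2)%N].
Proof.
elim/ltn_ind: n => n IHn n0.
have [/existsP[d /andP[d1 /dvdnP[n' nE]]]|noD] :=
    boolP [exists d : 'I_n.+1, (1 < d)%N && (d ^ 2 %| n)%N].
  have n'0 : (0 < n')%N by move: n0; rewrite nE muln_gt0 => /andP[].
  have [|N [r [N0 sqfN n'E]]] := IHn n' _ n'0.
    by rewrite nE ltn_Pmulr // (ltn_exp2l 0 2 d1).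
  exists N, (r * d)%N; split=> //.
  by rewrite [LHS]nE n'E expnMn mulnA.
exists n, 1%N; split; rewrite ?muln1 // => d dvd_n.
have d0 : (0 < d)%N.
  by case: d dvd_n => //; rewrite dvd0n => /eqP n0E; rewrite n0E in n0.
have d_le : (d <= n)%N.
  by apply: leq_trans (dvdn_leq n0 dvd_n); rewrite -{1}(expn1 d) leq_pexp2l.
move/existsPn/(_ (Ordinal (d_le : (d < n.+1)%N))): noD.
by rewrite /= dvd_n andbT -leqNgt => d1; apply/eqP; rewrite eqn_leq d1 d0.
Qed.

(** * From points on the curve to triangles *)

Lemma curve_factors_neq0 {F : fieldType} (N x y : F) :
  y != 0 -> y ^+ 2 = x ^+ 3 - N ^+ 2 * x ->
  [/\ x != 0, x + N != 0 & x - N != 0].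
Proof.
move=> y0 yE.
have : x * (x + N) * (x - N) != 0.
  have -> : x * (x + N) * (x - N) = y ^+ 2 by rewrite yE; ring.
  by rewrite expf_neq0.
by rewrite !mulf_eq0 !negb_or => /andP[/andP[]].
Qed.

(** The quotient of the two expressions for (x^2 - N^2)(z^2 - N^2), one from
    the curve and the other from the formulas, exhibits xz as a square. *)
Lemma product_is_square {F : fieldType} (N k x z y y' p q : F) :
    k != 0 -> y != 0 -> y' != 0 ->
    y ^+ 2 = x ^+ 3 - N ^+ 2 * x -> y' ^+ 2 = z ^+ 3 - N ^+ 2 * z ->
    p ^+ 2 = k * (x * z * (x + N) * (z + N)) ->
    q ^+ 2 = k * (x * z * (x - N) * (z - N)) ->
  x * z = (k * x * z * y * y' / (p * q)) ^+ 2.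
Proof.
move=> k0 y0 y'0 yE y'E pE qE.
have [x0 xp0 xm0] := curve_factors_neq0 y0 yE.
have [z0 zp0 zm0] := curve_factors_neq0 y'0 y'E.
rewrite !exprMn exprVn exprMn yE y'E pE qE.
by field; rewrite k0 x0 z0 xp0 zp0 xm0 zm0.
Qed.

(** If xz = N^2, then (x + N)(z + N) and (x - N)(z - N) have opposite signs,
    so p^2 and q^2 would too. *)
Lemma product_neq_sqr {F : realFieldType} (N k x z p q : F) :
    p != 0 -> q != 0 ->
    p ^+ 2 = k * (x * z * (x + N) * (z + N)) ->
    q ^+ 2 = k * (x * z * (x - N) * (z - N)) ->
  x * z != N ^+ 2.
Proof.
move=> p0 q0 pE qE; apply/eqP => xzE.
have pq_gt0 : 0 < (p * q) ^+ 2 by rewrite exprn_even_gt0 // mulf_neq0.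
have pqE : (p * q) ^+ 2 = - (k * (x * z) * N * (x - z)) ^+ 2.
  have -> : (p * q) ^+ 2
      = (k * (x * z)) ^+ 2 * ((x * z + N ^+ 2) ^+ 2 - N ^+ 2 * (x + z) ^+ 2).
    by rewrite exprMn pE qE; ring.
  have -> : (x * z + N ^+ 2) ^+ 2 - N ^+ 2 * (x + z) ^+ 2
      = - (N * (x - z)) ^+ 2 + (x * z - N ^+ 2) ^+ 2 by ring.
  by rewrite xzE; ring.
by move: pq_gt0; rewrite pqE oppr_gt0 ltNge sqr_ge0.
Qed.

Lemma formulas_nontrivial (R : rcfType) (N : nat) (k : int) (x z : rat)
    (c p q : int) :
  admissible N x z -> formulas R N k x z c p q -> k != 0 ->
  nontrivial_solution c p q.
Proof.
move=> [N0 _ [y [y0 yE]] [y' [y'0 y'E]] xz_neq] [cE pE qE] k0.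
have K0 : k%:~R != 0 :> rat by rewrite intr_eq0.
have M0 : N%:R != 0 :> rat by rewrite pnatr_eq0 -lt0n.
have [x0 xp0 xm0] := curve_factors_neq0 y0 yE.
have [z0 zp0 zm0] := curve_factors_neq0 y'0 y'E.
have p0 : p%:~R != 0 :> rat.
  by rewrite -sqrf_eq0 pE !mulf_neq0.
have q0 : q%:~R != 0 :> rat.
  by rewrite -sqrf_eq0 qE !mulf_neq0.
have sE := product_is_square K0 y0 y'0 yE y'E pE qE.
have xz_neqN := product_neq_sqr p0 q0 pE qE.
set s := `|k%:~R * x * z * y * y' / (p%:~R * q%:~R)|.
have {}sE : x * z = s ^+ 2 by rewrite sE /s real_normK ?num_real.
have s0 : s != 0 by rewrite -sqrf_eq0 -sE mulf_neq0.
have {}cE : c%:~R = k%:~R * s * ((x + z) * (x * z + N%:R ^+ 2)).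
  apply: (fmorph_inj (ratr : {rmorphism rat -> R})).
  rewrite /= ratr_int cE sE rmorphXn /= sqrtr_sqr ger0_norm ?ler0q ?normr_ge0 //.
  by rewrite !rmorphM /= ratr_int.
have xz_gt0 : 0 < x * z by rewrite sE exprn_even_gt0.
have sum0 : x + z != 0.
  apply/eqP=> xz0; have zE : z = - x by apply: (addrI x); rewrite xz0 subrr.
  by move: xz_gt0; rewrite zE mulrN oppr_gt0 -expr2 ltNge sqr_ge0.
have diff0 : x - z != 0 by rewrite subr_eq0.
have SN0 : x * z + N%:R ^+ 2 != 0 by rewrite gt_eqF // addr_gt0 // exprn_even_gt0.
have SN0' : x * z - N%:R ^+ 2 != 0 by rewrite subr_eq0.
have a1E : (p ^+ 2 + q ^+ 2)%:~R = 2 * k%:~R * s ^+ 2 * (x * z + N%:R ^+ 2) :> rat.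
  by rewrite rmorphD /= !rmorphXn /= pE qE -sE; ring.
have a2E : (p ^+ 2 - q ^+ 2)%:~R = 2 * k%:~R * s ^+ 2 * N%:R * (x + z) :> rat.
  by rewrite rmorphB /= !rmorphXn /= pE qE -sE; ring.
have B1E : (c ^+ 2 - (p ^+ 2 + q ^+ 2) ^+ 2)%:~R
    = (k%:~R * s * (x * z + N%:R ^+ 2) * (x - z)) ^+ 2 :> rat.
  rewrite rmorphB /= rmorphXn /= rmorphXn /= a1E cE.
  transitivity ((k%:~R * s * (x * z + N%:R ^+ 2)) ^+ 2
                * ((x + z) ^+ 2 - 4 * s ^+ 2) : rat); first by ring.
  by rewrite -sE; ring.
have B2E : (c ^+ 2 - (p ^+ 2 - q ^+ 2) ^+ 2)%:~R
    = (k%:~R * s * (x + z) * (x * z - N%:R ^+ 2)) ^+ 2 :> rat.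
  rewrite rmorphB /= rmorphXn /= rmorphXn /= a2E cE.
  transitivity ((k%:~R * s * (x + z)) ^+ 2
      * ((x * z + N%:R ^+ 2) ^+ 2 - 4 * s ^+ 2 * N%:R ^+ 2) : rat); first by ring.
  by rewrite -sE; ring.
have [b1 b1E] := is_square_of_rat B1E.
have [b2 b2E] := is_square_of_rat B2E.
have c0 : c != 0 by rewrite -(intr_eq0 rat) cE !mulf_neq0.
have a10 : p ^+ 2 + q ^+ 2 != 0.
  by rewrite -(intr_eq0 rat) a1E !mulf_neq0 ?expf_neq0.
have a20 : p ^+ 2 - q ^+ 2 != 0.
  by rewrite -(intr_eq0 rat) a2E !mulf_neq0 ?expf_neq0.
have b10 : b1 != 0.
  by rewrite -sqrf_eq0 -b1E -(intr_eq0 rat) B1E expf_neq0 // !mulf_neq0.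
have b20 : b2 != 0.
  by rewrite -sqrf_eq0 -b2E -(intr_eq0 rat) B2E expf_neq0 // !mulf_neq0.
exists b1, b2; split=> //; first by rewrite !mulf_neq0.
- by rewrite -(intr_eq0 rat) !rmorphM /= !mulf_neq0 // intr_eq0.
- by apply: contra_neq a20 => ->; rewrite subrr.
Qed.

Lemma formulas_solution (R : rcfType) (N : nat) (k : int) (x z : rat)
    (c p q : int) :
  admissible N x z -> formulas R N k x z c p q -> is_solution c p q.
Proof.
move=> adm form; have [k0|k0] := eqVneq k 0; last first.
  have [b1 [b2 [b1E b2E _ _ _]]] := formulas_nontrivial adm form k0.
  by split; [exists b1 | exists b2].
move: form; rewrite k0 => -[/eqP + /eqP + /eqP].
rewrite !mul0r !sqrf_eq0 !intr_eq0 => /eqP-> /eqP-> /eqP->.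
by split; exists 0.
Qed.

(** * From triangles to points on the curve *)

(** The candidate point is x = N t w, where t = (c + b2) / a2 and
    w = (c + b1) / a1 are the rational parameters of the triangles (a2, b2, c)
    and (a1, b1, c).  Its companion z = N t / w is the same expression with b1
    replaced by - b1, because (c + b1)(c - b1) = a1^2. *)
Definition triangle_x {F : fieldType} (N c a1 a2 b1 b2 : F) : F :=
  N * ((c + b1) * (c + b2)) / (a1 * a2).

Section TrianglePoint.
Context {F : fieldType} (N c a1 a2 b1 b2 : F).
Hypotheses (a1_neq0 : a1 != 0) (a2_neq0 : a2 != 0).
Hypotheses (b1E : c ^+ 2 - a1 ^+ 2 = b1 ^+ 2) (b2E : c ^+ 2 - a2 ^+ 2 = b2 ^+ 2).

Let a1E : a1 ^+ 2 = (c + b1) * (c - b1).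
Proof. by rewrite mulrC -subr_sqr -b1E; ring. Qed.

Let a2E : a2 ^+ 2 = (c + b2) * (c - b2).
Proof. by rewrite mulrC -subr_sqr -b2E; ring. Qed.

Local Notation x := (triangle_x N c a1 a2 b1 b2).
Local Notation z := (triangle_x N c a1 a2 (- b1) b2).

(** With u = x / N, the factor u^2 - 1 has numerator
    ((c + b1)(c + b2))^2 - (a1 a2)^2, and (a1 a2)^2 is the product of
    (c + b1)(c + b2) with its conjugate (c - b1)(c - b2); the difference of the
    two conjugates is 2c (b1 + b2). *)
Lemma triangle_x_curve :
  x ^+ 3 - N ^+ 2 * x = N ^+ 3 * (2 * c * a1 * a2 * (b1 + b2))
                        * ((c + b1) * (c + b2) / (a1 * a2) ^+ 2) ^+ 2.
Proof.
have -> : x ^+ 3 - N ^+ 2 * x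
    = N ^+ 3 * ((c + b1) * (c + b2)) * a1 * a2
      * (((c + b1) * (c + b2)) ^+ 2 - a1 ^+ 2 * a2 ^+ 2) / ((a1 * a2) ^+ 2) ^+ 2.
  by rewrite /triangle_x; field; rewrite a1_neq0 a2_neq0.
rewrite a1E a2E.
by field; rewrite a1_neq0 a2_neq0.
Qed.

Lemma triangle_x_mul : x * z = (N * (c + b2) / a2) ^+ 2.
Proof.
have -> : x * z = (N * (c + b2) / a2) ^+ 2 * ((c + b1) * (c - b1)) / a1 ^+ 2.
  by rewrite /triangle_x; field; rewrite a1_neq0 a2_neq0.
by rewrite -a1E mulfK // expf_neq0.
Qed.

Lemma triangle_x_add : x + z = 2 * N * c * (c + b2) / (a1 * a2).
Proof. by rewrite /triangle_x; field; rewrite a1_neq0 a2_neq0. Qed.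

Lemma triangle_x_mul_add :
  x * z + N ^+ 2 = 2 * N ^+ 2 * c * (c + b2) / a2 ^+ 2.
Proof.
rewrite triangle_x_mul.
have -> : (N * (c + b2) / a2) ^+ 2 + N ^+ 2
    = N ^+ 2 * ((c + b2) ^+ 2 + a2 ^+ 2) / a2 ^+ 2 by field.
by rewrite a2E; congr (_ / _); ring.
Qed.

(** The value of k that the equation a1 = 2k xz (xz + N^2) imposes. *)
Definition triangle_k : F := a1 * a2 ^+ 4 / (4 * N ^+ 4 * c * (c + b2) ^+ 3).

Hypotheses (N_neq0 : N != 0) (c_neq0 : c != 0) (cb2_neq0 : c + b2 != 0).
Hypothesis two_neq0 : 2 != 0 :> F.

Let four_neq0 : 4 != 0 :> F.
Proof. by rewrite (_ : 4 = 2 * 2) ?mulf_neq0 //; ring. Qed.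

Lemma triangle_k_legs :
  a1 = 2 * triangle_k * (x * z) * (x * z + N ^+ 2) /\
  a2 = 2 * triangle_k * (x * z) * N * (x + z).
Proof.
rewrite triangle_x_mul_add triangle_x_mul triangle_x_add /triangle_k.
by split; field; rewrite ?(a1_neq0, a2_neq0, N_neq0, c_neq0, cb2_neq0, four_neq0).
Qed.

Lemma triangle_k_hypotenuse :
  c = triangle_k * (N * (c + b2) / a2) * ((x + z) * (x * z + N ^+ 2)).
Proof.
rewrite triangle_x_mul_add triangle_x_add /triangle_k.
by field; rewrite ?(a1_neq0, a2_neq0, N_neq0, c_neq0, cb2_neq0, four_neq0).
Qed.

End TrianglePoint.

(** Used with a = a2 to see that 2c a1 a2 (b1 + b2) is positive; the first
    hypothesis then holds because b2^2 - b1^2 = (2pq)^2. *)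
Lemma dominant_sign {F : realDomainType} (a b1 b2 : F) :
  b1 ^+ 2 < b2 ^+ 2 -> 0 < a * b2 -> 0 < a * (b1 + b2).
Proof.
move=> lt_b ab2.
have b20 : b2 != 0 by apply: contraTneq ab2 => ->; rewrite mulr0 ltxx.
have bb : 0 < b2 * (b1 + b2) by nra.
have : 0 < (a * b2) * (b2 * (b1 + b2)) by rewrite mulr_gt0.
have -> : (a * b2) * (b2 * (b1 + b2)) = b2 ^+ 2 * (a * (b1 + b2)) by ring.
by rewrite pmulr_rgt0 // exprn_even_gt0.
Qed.

(** The converse once c > 0 and b2 has the sign of a2 = p^2 - q^2. *)
Lemma formulas_complete (R : rcfType) (c p q b1 b2 : int) :
    let a1 := p ^+ 2 + q ^+ 2 in
    let a2 := p ^+ 2 - q ^+ 2 in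
    c ^+ 2 - a1 ^+ 2 = b1 ^+ 2 -> c ^+ 2 - a2 ^+ 2 = b2 ^+ 2 ->
    0 < c -> p != 0 -> q != 0 -> b1 != 0 -> 0 < a2 * b2 ->
  exists (m : int) (N : nat) (k : int) (x z : rat),
    [/\ 0 < m, admissible N x z &
        formulas R N k x z (Num.sg a2 * m ^+ 2 * c) (m * p) (m * q)].
Proof.
move=> a1 a2 b1E b2E c0 p0 q0 b10 ab2.
have p2_gt0 : 0 < p ^+ 2 by rewrite exprn_even_gt0.
have q2_gt0 : 0 < q ^+ 2 by rewrite exprn_even_gt0.
have a1_gt0 : 0 < a1 by rewrite addr_gt0.
have a20 : a2 != 0 by apply: contraTneq ab2 => ->; rewrite mul0r ltxx.
have bbE : b2 ^+ 2 - b1 ^+ 2 = (2 * p * q) ^+ 2.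
  by rewrite -b1E -b2E /a1 /a2; ring.
have lt_b : b1 ^+ 2 < b2 ^+ 2.
  by rewrite -subr_gt0 bbE exprn_even_gt0 //= !mulf_neq0.
have n_gt0 : 0 < 2 * c * a1 * a2 * (b1 + b2).
  by rewrite -mulrA; apply: mulr_gt0; [rewrite !mulr_gt0 | exact: dominant_sign].
have bb0 : b1 + b2 != 0 by apply: contraTneq n_gt0 => ->; rewrite mulr0 ltxx.
have cb2_gt0 : 0 < c + b2.
  have : 0 < (c + b2) * (c - b2).
    by rewrite mulrC -subr_sqr -b2E subKr exprn_even_gt0.
  nra.
have [N [r [N_gt0 sqfN nE]]] : exists N r : nat,
    [/\ (0 < N)%N, squarefree N
      & 2 * c * a1 * a2 * (b1 + b2) = N%:Z * r%:Z ^+ 2].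
  have [|N [r [N_gt0 sqfN nE]]] := @squarefree_part `|2 * c * a1 * a2 * (b1 + b2)|.
    by rewrite absz_gt0 gt_eqF.
  by exists N, r; split=> //; rewrite -[LHS]gtz0_abs // nE PoszM -rmorphXn.
pose Q (u : int) : rat := u%:~R.
have Q0 u : u != 0 -> Q u != 0 by rewrite /Q intr_eq0.
have N0 : N%:R != 0 :> rat by rewrite pnatr_eq0 -lt0n.
have r0 : r%:R != 0 :> rat.
  rewrite pnatr_eq0; apply: contraTneq n_gt0 => r0.
  by rewrite nE r0 expr0n mulr0 ltxx.
have A10 : Q a1 != 0 by rewrite Q0 // gt_eqF.
have A20 := Q0 _ a20.
have C0 : Q c != 0 by rewrite Q0 // gt_eqF.
have CB2_gt0 : 0 < Q c + Q b2 by rewrite /Q -rmorphD ltr0z.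
have CB20 : Q c + Q b2 != 0 by rewrite gt_eqF.
have BB0 : Q b1 + Q b2 != 0 by rewrite /Q -rmorphD Q0.
have B1E : Q c ^+ 2 - Q a1 ^+ 2 = Q b1 ^+ 2.
  by rewrite /Q -!rmorphXn -rmorphB b1E.
have B1E' : Q c ^+ 2 - Q a1 ^+ 2 = (- Q b1) ^+ 2 by rewrite sqrrN.
have B2E : Q c ^+ 2 - Q a2 ^+ 2 = Q b2 ^+ 2.
  by rewrite /Q -!rmorphXn -rmorphB b2E.
have BBE : Q b2 ^+ 2 - Q b1 ^+ 2 = (2 * Q p * Q q) ^+ 2.
  by rewrite /Q -!rmorphXn -rmorphB bbE /= !rmorphXn !rmorphM.
have A1E : Q a1 = Q p ^+ 2 + Q q ^+ 2 by rewrite /Q rmorphD !rmorphXn.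
have A2E : Q a2 = Q p ^+ 2 - Q q ^+ 2 by rewrite /Q rmorphB !rmorphXn.
clearbody a1 a2.
have NE : 2 * Q c * Q a1 * Q a2 * (Q b1 + Q b2) = N%:R * r%:R ^+ 2.
  transitivity (Q (2 * c * a1 * a2 * (b1 + b2))).
    by rewrite /Q !rmorphM (rmorphD _ b1).
  by rewrite nE /Q rmorphM rmorphXn.
have NE' : 2 * Q c * Q a1 * Q a2 * (- Q b1 + Q b2)
    = N%:R * (r%:R * (2 * Q p * Q q) / (Q b1 + Q b2)) ^+ 2.
  apply: (mulIf BB0).
  have -> : 2 * Q c * Q a1 * Q a2 * (- Q b1 + Q b2) * (Q b1 + Q b2)
      = 2 * Q c * Q a1 * Q a2 * (Q b2 ^+ 2 - Q b1 ^+ 2) by ring.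
  rewrite BBE; apply: (mulIf BB0).
  transitivity (2 * Q c * Q a1 * Q a2 * (Q b1 + Q b2) * (2 * Q p * Q q) ^+ 2).
    by ring.
  by rewrite NE; field.
pose x := triangle_x N%:R (Q c) (Q a1) (Q a2) (Q b1) (Q b2).
pose z := triangle_x N%:R (Q c) (Q a1) (Q a2) (- Q b1) (Q b2).
have cb1 : (Q c + Q b1) * (Q c - Q b1) != 0.
  by rewrite (_ : _ * _ = Q a1 ^+ 2) ?expf_neq0 // mulrC -subr_sqr -B1E; ring.
have [cb1p cb1m] : Q c + Q b1 != 0 /\ Q c - Q b1 != 0.
  by move: cb1; rewrite mulf_eq0 negb_or => /andP[].
have xC : nontrivial_congruent N x.
  exists (N%:R ^+ 2 * r%:R * ((Q c + Q b1) * (Q c + Q b2) / (Q a1 * Q a2) ^+ 2)).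
  split; first by rewrite !mulf_neq0 ?invr_neq0 // ?expf_neq0 ?mulf_neq0.
  by rewrite triangle_x_curve // NE; ring.
have zC : nontrivial_congruent N z.
  exists (N%:R ^+ 2 * (r%:R * (2 * Q p * Q q) / (Q b1 + Q b2))
          * ((Q c - Q b1) * (Q c + Q b2) / (Q a1 * Q a2) ^+ 2)).
  split; last by rewrite triangle_x_curve // NE'; ring.
  by rewrite !mulf_neq0 ?invr_neq0 // ?expf_neq0 ?mulf_neq0 ?(Q0 p) ?(Q0 q).
have xz : x != z.
  rewrite -subr_eq0.
  have -> : x - z = 2 * N%:R * Q b1 * (Q c + Q b2) / (Q a1 * Q a2).
    by rewrite /x /z /triangle_x; field; rewrite A10 A20.
  by rewrite !mulf_neq0 ?invr_neq0 ?mulf_neq0 ?(Q0 b1).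
pose k := triangle_k N%:R (Q c) (Q a1) (Q a2) (Q b2).
have two0 : 2 != 0 :> rat by [].
have [k1 k2] := triangle_k_legs A10 A20 B1E B2E N0 C0 CB20 two0.
have kc := triangle_k_hypotenuse A10 A20 B1E B2E N0 C0 CB20 two0.
have xzE := triangle_x_mul N%:R (Q b2) A10 A20 B1E.
rewrite -/x -/z -/k in k1 k2 kc xzE.
exists (denq k), N, (numq k * denq k), x, z.
(* Replacing (p, q) by (m p, m q) multiplies k by m^2. *)
have kE : (numq k * denq k)%:~R = (denq k)%:~R ^+ 2 * k.
  by rewrite rmorphM /= numqE; ring.
split; [exact: denq_gt0 | by split | split].
- (* The square root is N |t|, whereas N t occurs in the expression of c. *)
  have sqrtE : Num.sqrt (ratr (x * z)) =
      ratr ((Num.sg a2)%:~R * (N%:R * (Q c + Q b2) / Q a2)) :> R.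
    rewrite xzE rmorphXn sqrtr_sqr -ratr_norm normrEsg /=; congr (ratr (_ * _)).
    by rewrite !sgrM sgrV (gtr0_sg CB2_gt0) gtr0_sg ?ltr0n // !mul1r intr_sg.
  rewrite sqrtE.
  rewrite -(ratr_int R) -(ratr_int R (_ * _)) -!rmorphM /=; congr ratr.
  by rewrite kE !rmorphM /= -/(Q c) {1}kc; ring.
- rewrite rmorphM exprMn /= kE -/(Q p).
  have -> : Q p ^+ 2 = (Q a1 + Q a2) / 2 by rewrite A1E A2E; field.
  by rewrite k1 k2; field.
- rewrite rmorphM exprMn /= kE -/(Q q).
  have -> : Q q ^+ 2 = (Q a1 - Q a2) / 2 by rewrite A1E A2E; field.
  by rewrite k1 k2; field.
Qed.

(** * The parametrization *)

Theorem theorem2 (R : rcfType) :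
  (forall (N : nat) (k : int) (x z : rat) (c p q : int),
     admissible N x z -> formulas R N k x z c p q ->
     is_solution c p q /\ (k != 0 -> nontrivial_solution c p q)) /\
  (forall c p q : int,
     nontrivial_solution c p q ->
     exists (m : int) (N : nat) (k : int) (x z : rat),
       [/\ 0 < m, admissible N x z &
           formulas R N k x z
             (Num.sg (c * (p ^+ 2 - q ^+ 2)) * m ^+ 2 * c) (m * p) (m * q)]).
Proof.
split=> [N k x z c p q adm form|c p q [b1 [b2 /= [b1E b2E legs0 cpq0 _]]]].
  split; first exact: formulas_solution adm form.
  exact: formulas_nontrivial adm form.
move: legs0 cpq0; rewrite !mulf_eq0 !negb_or.
move=> /andP[/andP[/andP[_ b10] c0] /andP[/andP[a20 b20] _]].
move=> /andP[/andP[_ p0] q0].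
(* The signs of c and b2 are free, as only their squares enter the system. *)
have b1E' : `|c| ^+ 2 - (p ^+ 2 + q ^+ 2) ^+ 2 = b1 ^+ 2.
  by rewrite real_normK ?num_real.
have b2E' : `|c| ^+ 2 - (p ^+ 2 - q ^+ 2) ^+ 2
    = (Num.sg (p ^+ 2 - q ^+ 2) * b2 * Num.sg b2) ^+ 2.
  by rewrite real_normK ?num_real // !exprMn !sqr_sg a20 b20 mul1r mulr1.
have sgE m : Num.sg (c * (p ^+ 2 - q ^+ 2)) * m ^+ 2 * c
    = Num.sg (p ^+ 2 - q ^+ 2) * m ^+ 2 * `|c|.
  by rewrite sgrM normrEsg; ring.
have [||m [N [k [x [z [m0 adm form]]]]]] :=
    @formulas_complete R _ _ _ _ _ b1E' b2E' _ p0 q0 b10.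
- by rewrite normr_gt0.
- rewrite (_ : _ * _ = `|p ^+ 2 - q ^+ 2| * `|b2|) ?mulr_gt0 ?normr_gt0 //.
  by rewrite !normrEsg; ring.
by exists m, N, k, x, z; rewrite sgE.
Qed.
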